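(* Let $A_1,\dots,A_m,B$ be symmetric $n\times n$ matrices with integer entries, with $A_1,\dots,A_m$ linearly independent, such that $$(P)\qquad x_1A_1+\dots+x_mA_m+B\succeq 0$$ is strictly feasible. Let $k$ be the singularity degree of the system $\{Y\succeq 0 : A_i\bullet Y=0,\ i=1,\dots,m\}$ (as defined in the context), and let $$(P')\qquad x_1A_1'+\dots+x_mA_m'+B'\succeq 0$$ be a reformulation of $(P)$ that is in regular form with this $k$. Assume $k\ge 2$. Fix reals $\bar x_{k+1},\dots,\bar x_m$ such that $(x_1,\dots,x_k,\bar x_{k+1},\dots,\bar x_m)$ is strictly feasible in $(P')$ for some $x_1,\dots,x_k$. Then: 1. There is $(x_1,\dots,x_k)$ such that $(x_1,\dots,x_k,\bar x_{k+1},\dots,\bar x_m)$ is strictly feasible in $(P')$ and $x_k$ is arbitrarily large (i.e., for every real $N$ there is such $(x_1,\dots,x_k)$ with $x_k\ge N$). 2. There are positive constants $d_2,\dots,d_k$ and $\alpha_2,\dots,\alpha_k$ such that, if $(x_1,\dots,x_k,\bar x_{k+1},\dots,\bar x_m)$ is strictly feasible in $(P')$ and $x_k$ is sufficiently large (larger than some constant), then $$x_j\ \ge\ d_{j+1}\,x_{j+1}^{\alpha_{j+1}}\qquad\text{for } j=1,\dots,k-1,$$ where $$2\ \ge\ \alpha_{j+1}\ \ge\ 1+\frac{1}{k-j}\qquad\text{for } j=1,\dots,k-1.$$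
   Context: Notation: $S\succeq 0$ (resp. $S\succ 0$) means the symmetric matrix $S$ is positive semidefinite (resp. positive definite); $S\bullet T:=\operatorname{trace}(ST)$. A point $x\in\mathbb R^m$ is strictly feasible in $x_1A_1+\dots+x_mA_m+B\succeq 0$ if $\sum_i x_iA_i+B\succ 0$; the problem is strictly feasible if such an $x$ exists. Regular facial reduction sequence: $(C_1,\dots,C_\ell)$ of symmetric $n\times n$ matrices is a regular facial reduction sequence if there are nonnegative integers $r_1,\dots,r_\ell$ such that for each $i$, writing $p=r_1+\dots+r_{i-1}$ (so $p=0$ for $i=1$), the diagonal block of $C_i$ with row and column indices $p+1,\dots,p+r_i$ is the identity, all other entries of $C_i$ whose row and column indices are both larger than $p$ are zero, and the entries with row or column index at most $p$ are arbitrary. $r_i$ is called the size of the identity block of $C_i$. Reformulation: a reformulation of $(P)$ is a problem obtained from it by applying finitely many of the following operations in any order: (1) exchange $A_i$ and $A_j$, $i\ne j$ in $\{1,\dots,m\}$; (2) replace $A_i$ by $\lambda A_i+\mu A_j$, where $i\neq j$ are in $\{1,\dots,m\}$, $\lambda,\mu\in\mathbb R$, $\lambda\ne 0$; (3) replace all $A_i$ by $T^\top A_iT$ and $B$ by $T^\top BT$ for an invertible matrix $T$. Regular form: a reformulation $\sum_i x_iA_i'+B'\succeq 0$ of $(P)$ is in regular form with nonnegative integer $k$ if $(A_1',\dots,A_k')$ is a regular facial reduction sequence and, with $r_1,\dots,r_k$ the sizes of the identity blocks in $A_1',\dots,A_k'$, the number $n-r_1-\dots-r_k$ is the maximum rank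 of a matrix in $\{Y\succeq 0: A_i\bullet Y=0,\ i=1,\dots,m\}$. The singularity degree of this last system is the smallest $k$ for which some reformulation of $(P)$ in regular form with $k$ exists (a reformulation in regular form always exists for some $k$). A constant is a number that depends only on the fixed $\bar x_i$, the matrices $A_i$ and $B$ (and the fixed reformulation), not on $x_1,\dots,x_k$. *)

(* Defs.v *)
From HB Require Import structures.
From mathcomp Require Import all_boot all_order all_fingroup all_algebra.
From mathcomp Require Import reals exp.

Set Implicit Arguments.
Unset Strict Implicit.
Unset Printing Implicit Defensive.

Import Order.TTheory GRing.Theory Num.Theory.
Local Open Scope ring_scope.

Section Defs.
Variable R : realType.

Definition psdmx n (S : 'M[R]_n) : Prop :=
  S \is symmetricmx /\ forall v : 'cV[R]_n, 0 <= (v^T *m S *m v) 0 0.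

Definition pdmx n (S : 'M[R]_n) : Prop :=
  S \is symmetricmx /\ forall v : 'cV[R]_n, v != 0 -> 0 < (v^T *m S *m v) 0 0.

(* [z] is a plain sequence, so that concatenations [x ++ y] whose length is
   only provably equal to [m] can be used; the entries are z`_0, ..., z`_m.-1. *)
Definition strictly_feasible n m (A : m.-tuple 'M[R]_n) (B : 'M[R]_n)
    (z : seq R) : Prop :=
  pdmx (\sum_(i < m) z`_i *: tnth A i + B).

Section Reformulation.
Variables (n m : nat) (A : m.-tuple 'M[R]_n) (B : 'M[R]_n).

Inductive reformulation : m.-tuple 'M[R]_n -> 'M[R]_n -> Prop :=
| reform_refl : reformulation A B
| reform_exchange A' B' (i j : 'I_m) :
    reformulation A' B' -> i != j ->
    reformulation [tuple tnth A' (tperm i j l) | l < m] B'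
| reform_replace A' B' (i j : 'I_m) (lambda mu : R) :
    reformulation A' B' -> i != j -> lambda != 0 ->
    reformulation
      [tuple if l == i then lambda *: tnth A' i + mu *: tnth A' j
             else tnth A' l | l < m] B'
| reform_congruence A' B' (T : 'M[R]_n) :
    reformulation A' B' -> T \in unitmx ->
    reformulation [tuple T^T *m tnth A' l *m T | l < m] (T^T *m B' *m T).

End Reformulation.

(* [r] lists the sizes of the identity blocks. The bound on [sumn r] says that
   all the blocks fit inside n x n matrices. With rows and columns numbered
   from 0, the i-th identity block occupies p, ..., p + r_i - 1. *)
Definition regular_fr_seq n (C : seq 'M[R]_n) (r : seq nat) : Prop :=
  [/\ size r = size C, (sumn r <= n)%N &
      forall i, (i < size C)%N ->
        C`_i \is symmetricmx /\
        let p := sumn (take i r) in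
        forall a b : 'I_n, (p <= a)%N -> (p <= b)%N ->
          C`_i a b = ((a == b) && (a < p + nth 0%N r i)%N)%:R].

Definition max_psd_rank n m (A : m.-tuple 'M[R]_n) (d : nat) : Prop :=
  let feasible (Y : 'M[R]_n) :=
    psdmx Y /\ forall i : 'I_m, \tr (tnth A i *m Y) = 0 in
  (exists2 Y, feasible Y & \rank Y = d) /\
  (forall Y, feasible Y -> (\rank Y <= d)%N).

Definition regular_form n m (A : m.-tuple 'M[R]_n) (B : 'M[R]_n)
    (k : nat) (A' : m.-tuple 'M[R]_n) (B' : 'M[R]_n) : Prop :=
  [/\ reformulation A B A' B', (k <= m)%N &
      exists2 r : seq nat, regular_fr_seq (take k A') r &
                           max_psd_rank A (n - sumn r)].

(* [k] is the singularity degree of { Y psd : tr (A_i Y) = 0 for all i }. *)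
Definition singularity_degree n m (A : m.-tuple 'M[R]_n) (B : 'M[R]_n)
    (k : nat) : Prop :=
  (exists A' B', regular_form A B k A' B') /\
  (forall k', (exists A' B', regular_form A B k' A' B') -> (k <= k')%N).

End Defs.

(* Main.v *)
Require Import Defs.
From HB Require Import structures.
From mathcomp Require Import all_boot all_order all_fingroup all_algebra.
From mathcomp Require Import reals exp.
From mathcomp Require Import boolp zify ring lra.

Set Implicit Arguments.
Unset Strict Implicit.
Unset Printing Implicit Defensive.

Import Order.TTheory GRing.Theory Num.Theory.
Local Open Scope ring_scope.

(** Write P_0 = 0 <= P_1 <= ... <= P_k for the partial sums of the block sizes.
    With the free coordinates fixed, the matrix of the reformulated problem is
    a pencil Z(x) = x_1 C_1 + ... + x_k C_k + D, where C_i is the identity on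
    its i-th block and zero on all other pairs of indices beyond P_{i-1}.

    Unboundedness of x_k: if Z(x) is positive definite on the indices beyond
    P_i, increasing x_i alone makes it positive definite on the indices beyond
    P_{i-1}, by a Schur complement argument ([pdmx_border]).  As there is no
    upper limit to the increase, starting from a strictly feasible point and
    going down from x_k to x_1 makes all the coordinates as large as desired
    ([cut_form_unbounded]).

    Growth of the coordinates: minimality of k provides, for every j < k, an
    index a in the j-th block and an index b beyond P_{j+1} where C_{j+1} does
    not vanish.  Otherwise l C_j + C_{j+1}, with l large, would be positive
    definite on the blocks j and j+1 taken together and zero after them; a
    congruence turns it into the identity there, which merges the two blocks
    and gives a regular form with k - 1 ([merge_blocks],
    [singularity_degree_tail]).  Consider the principal minor of Z(x) in the
    rows a and b.  Let S_i = 1 + |x_i| + ... + |x_k|, so that S_{k+1} = 1.  The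
    diagonal entries are at most x_j + O(S_{j+1}) and O(S_{j+2}), while the
    off-diagonal one is a nonzero multiple of x_{j+1} up to O(S_{j+2})
    ([minor_bounds]).  When x_{j+1} dominates S_{j+2}, positivity of the minor
    gives x_j S_{j+2} >= c x_{j+1}^2 ([growth_step]).

    By descending induction on j, for x_k large, x_j dominates S_{j+1} and
    x_j^{k-j} >= c S_{j+1}^{k-j+1} ([growth]): raise the quadratic inequality
    to the power k - j and bound S_{j+2}^{k-j} by a multiple of
    x_{j+1}^{k-j-1}, which is the induction hypothesis.  Hence the exponents
    alpha_{j+1} = 1 + 1/(k-j) have the required property. *)

(** * Positive definite matrices *)

Section PositiveDefinite.
Variable R : realType.

Lemma symmetricmxP n (Z : 'M[R]_n) : reflect (Z^T = Z) (Z \is symmetricmx).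
Proof.
rewrite is_hermitianmxE expr0 scale1r map_mx_id //.
by apply: (iffP eqP) => /esym.
Qed.

Lemma pdmx_congr n m (Z : 'M[R]_n) (T : 'M[R]_(n, m)) :
  pdmx Z -> (forall v : 'cV_m, T *m v = 0 -> v = 0) -> pdmx (T^T *m Z *m T).
Proof.
move=> [/symmetricmxP Zs Zpos] T_inj; split.
  by apply/symmetricmxP; rewrite !trmx_mul trmxK Zs mulmxA.
move=> v v0; have := Zpos (T *m v); rewrite trmx_mul !mulmxA; apply.
by apply: contra v0 => /eqP/T_inj->.
Qed.

Lemma pdmx_congr_unit n (Z T : 'M[R]_n) :
  T \in unitmx -> pdmx (T^T *m Z *m T) -> pdmx Z.
Proof.
move=> Tu Zpd.
have -> : Z = (invmx T)^T *m (T^T *m Z *m T) *m invmx T.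
  by rewrite -!mulmxA mulmxV // mulmx1 mulmxA -trmx_mul mulmxV // trmx1 mul1mx.
apply: pdmx_congr => // v Tv.
by rewrite -(mulKVmx Tu v) Tv mulmx0.
Qed.

Lemma pdmx_mxsub n m (Z : 'M[R]_n) (f : 'I_m -> 'I_n) :
  injective f -> pdmx Z -> pdmx (mxsub f f Z).
Proof.
move=> f_inj Zpd.
have -> : mxsub f f Z = (colsub f 1%:M)^T *m Z *m colsub f 1%:M.
  by rewrite trmx_mxsub trmx1 mul_rowsub_mx mul1mx mulmx_colsub mulmx1 -mxsub_comp.
apply: pdmx_congr => // v v0; apply/colP => i.
have := congr1 (fun w : 'cV_n => w (f i) 0) v0.
rewrite !mxE (bigD1 i) //= !mxE eqxx mul1r big1 ?addr0 // => j ji.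
by rewrite !mxE (inj_eq f_inj) eq_sym (negPf ji) mul0r.
Qed.

Lemma pdmx1 n : pdmx (1%:M : 'M[R]_n).
Proof.
split; first by apply/symmetricmxP; rewrite trmx1.
move=> v v0; rewrite mulmx1 mxE.
have [i vi] : exists i, v i 0 != 0.
  apply/existsP; apply: contraR v0 => /existsPn v0.
  by apply/eqP/colP => i; rewrite mxE; have /negPn/eqP := v0 i.
rewrite (bigD1 i) //= mxE -expr2 ltr_pwDl ?exprn_even_gt0 //.
by apply: sumr_ge0 => j _; rewrite mxE -expr2 sqr_ge0.
Qed.

Lemma pdmx_unit n (Z : 'M[R]_n) : pdmx Z -> Z \in unitmx.
Proof.
move=> [/symmetricmxP Zs Zpos]; rewrite -row_free_unit -kermx_eq0.
apply/eqP/row_matrixP => i; rewrite row0; set w := row i _.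
have wZ : w *m Z = 0 by rewrite -row_mul mulmx_ker row0.
apply: trmx_inj; rewrite trmx0; apply/eqP; apply: contraT => w0.
by have := Zpos _ w0; rewrite trmxK wZ mul0mx mxE ltxx.
Qed.

Lemma pdmx_block_diag s t (P : 'M[R]_s) (D : 'M[R]_t) :
  pdmx P -> pdmx D -> pdmx (block_mx P 0 0 D).
Proof.
move=> [/symmetricmxP Ps Ppos] [/symmetricmxP Ds Dpos]; split.
  by apply/symmetricmxP; rewrite tr_block_mx Ps Ds !trmx0.
move=> v; rewrite -[v]vsubmxK; move: (usubmx v) (dsubmx v) => x y xy0.
rewrite tr_col_mx mul_row_block !mulmx0 add0r addr0 mul_row_col mxE.
have [x0|x0] := eqVneq x 0.
  rewrite x0 mulmx0 mxE add0r; apply: Dpos; apply: contra xy0 => /eqP->.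
  by rewrite x0 col_mx0.
have Py : 0 <= (y^T *m D *m y) 0 0.
  by have [->|/Dpos/ltW//] := eqVneq y 0; rewrite mulmx0 mxE.
by apply: ltr_pwDl => //; apply: Ppos.
Qed.

(** Completing the square: a positive definite lower right block eliminates
    the off-diagonal blocks, by a shear that fixes the matrix of the square
    norm of the upper coordinates. *)
Lemma schur_shear s t (Z : 'M[R]_(s + t)) :
  Z \is symmetricmx -> pdmx (drsubmx Z) ->
  exists (G : 'M[R]_(s + t)) (S : 'M[R]_s),
    [/\ G \in unitmx, S \is symmetricmx,
        G^T *m Z *m G = block_mx S 0 0 (drsubmx Z) &
        G^T *m block_mx 1%:M 0 0 0 *m G = block_mx 1%:M 0 0 0].
Proof.
move=> /symmetricmxP; rewrite -[Z]submxK block_mxKdr.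
move: (ulsubmx Z) (ursubmx Z) (dlsubmx Z) (drsubmx Z) => P Q Q' D.
rewrite tr_block_mx => /eq_block_mx[Ps Qs _ Ds] Dpd.
have [X DX] : exists X, D *m X = Q'.
  by exists (invmx D *m Q'); rewrite mulKVmx // pdmx_unit.
have XD : X^T *m D = Q by rewrite -Qs -DX trmx_mul Ds.
exists (block_mx 1%:M 0 (- X) 1%:M), (P - X^T *m D *m X); split.
- by rewrite unitmxE det_lblock !det1 mulr1 unitr1.
- by apply/symmetricmxP; rewrite linearB /= Ps !trmx_mul trmxK Ds mulmxA.
- rewrite tr_block_mx !mulmx_block !trmx1 !trmx0 linearN /=.
  rewrite ?(mul1mx, mulmx1, mul0mx, mulmx0, addr0, add0r).
  rewrite !mulNmx !mulmxN XD subrr mul0mx DX subrr.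
  by rewrite subr0 -DX mulmxA XD.
- rewrite tr_block_mx !mulmx_block !trmx1 !trmx0.
  by rewrite ?(mul1mx, mulmx1, mul0mx, mulmx0, addr0, add0r).
Qed.

(** The sum of the absolute values of the entries of [S] bounds the quadratic
    form of [S] against the square norm. *)
Lemma pdmx_shift n (S : 'M[R]_n) : S \is symmetricmx ->
  exists l0 : R, forall l, l0 <= l -> pdmx (S + l%:M).
Proof.
move=> /symmetricmxP Ss; pose K := \sum_i \sum_j `|S i j|.
exists (K + 1) => l Kl; split.
  by apply/symmetricmxP; rewrite linearD /= Ss tr_scalar_mx.
move=> v v0; pose q := \sum_i v i 0 ^+ 2.
have q_gt0 : 0 < q.
  have [_ /(_ v v0)] := pdmx1 n; rewrite mulmx1 mxE /q.
  by under eq_bigr do rewrite mxE -expr2.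
have le_q i j : `|v i 0 * v j 0| <= q.
  have leq1 k : `|v k 0| ^+ 2 <= q.
    rewrite real_normK ?num_real // /q (bigD1 k) //= lerDl.
    by apply: sumr_ge0 => *; rewrite sqr_ge0.
  rewrite normrM; have := leq1 i; have := leq1 j.
  by have := sqr_ge0 (`|v i 0| - `|v j 0|); nra.
rewrite mulmxDr mulmxDl mxE.
have -> : (v^T *m l%:M *m v) 0 0 = l * q.
  rewrite mul_mx_scalar -scalemxAl mxE; congr (_ * _).
  by rewrite mxE; apply: eq_bigr => i _; rewrite mxE expr2.
suff : - (K * q) <= (v^T *m S *m v) 0 0 by nra.
have -> : (v^T *m S *m v) 0 0 = \sum_j \sum_i v i 0 * S i j * v j 0.
  rewrite mxE; apply: eq_bigr => j _; rewrite mxE mulr_suml.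
  by apply: eq_bigr => i _; rewrite !mxE.
rewrite -lerNl; apply: le_trans (ler_norm _) _; rewrite normrN.
rewrite exchange_big /K mulr_suml; apply: le_trans (ler_norm_sum _ _ _) _.
apply: ler_sum => i _; rewrite mulr_suml; apply: le_trans (ler_norm_sum _ _ _) _.
apply: ler_sum => j _; rewrite mulrAC normrM mulrC.
by apply: ler_wpM2l.
Qed.

(** The shear of [schur_shear] separates the two blocks and leaves the added
    term as it is, so only the Schur complement of [drsubmx Z] has to be
    shifted. *)
Lemma pdmx_border s t (Z : 'M[R]_(s + t)) :
  Z \is symmetricmx -> pdmx (drsubmx Z) ->
  exists l0 : R, forall l, l0 <= l -> pdmx (Z + l *: block_mx 1%:M 0 0 0).
Proof.
move=> Zs Dpd; have [G [S [Gu Ss GZ GE]]] := schur_shear Zs Dpd.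
have [l0 l0P] := pdmx_shift Ss; exists l0 => l ll0.
apply: (pdmx_congr_unit Gu).
rewrite mulmxDr mulmxDl -scalemxAr -scalemxAl GZ GE scale_block_mx add_block_mx.
rewrite !scaler0 !addr0 scalemx1.
by apply: pdmx_block_diag => //; apply: l0P.
Qed.

(** Induction on the size, splitting off the first coordinate with
    [schur_shear]. *)
Lemma pdmx_cholesky n (Z : 'M[R]_n) :
  pdmx Z -> exists2 T, T \in unitmx & T^T *m Z *m T = 1%:M.
Proof.
elim: n Z => [|n IHn] Z Zpd.
  exists 1%:M; first exact: unitmx1.
  by apply/matrixP; case.
move: Z Zpd; rewrite -[n.+1]/(1 + n)%N => Z Zpd.
have Dpd : pdmx (drsubmx Z).
  by rewrite drsubmxEsub; apply: pdmx_mxsub => //; apply: rshift_inj.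
have [G [S [Gu Ss GZ _]]] := schur_shear Zpd.1 Dpd.
have [T Tu TD] := IHn _ Dpd.
have S_gt0 : 0 < S 0 0.
  have : pdmx (block_mx S 0 0 (drsubmx Z)).
    by rewrite -GZ; apply: pdmx_congr => // v Gv; rewrite -(mulKmx Gu v) Gv mulmx0.
  move=> /(pdmx_mxsub (@lshift_inj 1 n)); rewrite -ulsubmxEsub block_mxKul.
  move=> [_ /(_ 1%:M)]; rewrite trmx1 mul1mx mulmx1; apply.
  by rewrite -scalemx1 scale1r matrix_nonzero1.
pose c := (Num.sqrt (S 0 0))^-1.
have c_neq0 : c != 0 by rewrite invr_eq0 sqrtr_eq0 -ltNge.
exists (G *m block_mx c%:M 0 0 T).
  rewrite unitmx_mul Gu /= unitmxE det_ublock unitrM.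
  by rewrite -(unitmxE T) Tu andbT det_scalar1 unitfE.
rewrite trmx_mul -!mulmxA (mulmxA Z) (mulmxA G^T) (mulmxA G^T) GZ.
rewrite tr_block_mx !mulmx_block !trmx0 tr_scalar_mx.
rewrite ?(mul0mx, mulmx0, addr0, add0r) (mulmxA T^T) TD.
rewrite (@scalar_mx_block _ 1 n); congr block_mx; rewrite [S]mx11_scalar -!scalar_mxM; congr _%:M.
rewrite mulrCA -expr2 exprVn sqr_sqrtr ?ltW // divff //.
by rewrite gt_eqF.
Qed.

Lemma pdmx_diag_gt0 n (Z : 'M[R]_n) a : pdmx Z -> 0 < Z a a.
Proof.
move=> [_ /(_ (delta_mx a 0))]; rewrite trmx_delta -rowE -colE !mxE; apply.
by apply/eqP => /matrixP/(_ a 0)/eqP; rewrite !mxE !eqxx oner_eq0.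
Qed.

Lemma pdmx_minor2 n (Z : 'M[R]_n) a b :
  pdmx Z -> a != b -> Z a b ^+ 2 <= Z a a * Z b b.
Proof.
move=> Zpd ab; have Zb := pdmx_diag_gt0 b Zpd.
have [/symmetricmxP Zs Zpos] := Zpd.
have Zba : Z b a = Z a b by rewrite -{1}Zs mxE.
(* Up to scaling, the minimizer of the quadratic form on the line e_a + R e_b. *)
pose v : 'cV[R]_n := Z b b *: delta_mx a 0 - Z a b *: delta_mx b 0.
have : 0 < (v^T *m Z *m v) 0 0.
  apply: Zpos; apply/eqP => /matrixP/(_ a 0)/eqP; rewrite !mxE !eqxx (negPf ab).
  by rewrite mulr0 subr0 mulr1 gt_eqF.
have -> : v^T = Z b b *: delta_mx 0 a - Z a b *: delta_mx 0 b.
  by rewrite /v linearB /= !linearZ /= !trmx_delta.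
rewrite /v mulmxBr !mulmxBl -!scalemxAr -!scalemxAl.
rewrite -!rowE -!colE !mxE Zba.
rewrite (_ : _ - _ = Z b b * (Z a a * Z b b - Z a b ^+ 2)); last by ring.
by rewrite pmulr_rgt0 // subr_gt0 => /ltW.
Qed.

End PositiveDefinite.

(** * Windows of consecutive indices *)

Section Windows.
Variable R : realType.

Fact win_subproof n p s (h : (p + s <= n)%N) (i : 'I_s) : (p + i < n)%N.
Proof. by apply: leq_trans h; rewrite ltn_add2l. Qed.

(** Principal submatrices are taken along [win] by [mxsub] instead of through
    block decompositions, because the cuts of a facial reduction sequence
    decompose [n] only up to a proved equation. *)
Definition win n p s (h : (p + s <= n)%N) (i : 'I_s) : 'I_n :=
  Ordinal (win_subproof h i).

Lemma win_inj n p s (h : (p + s <= n)%N) : injective (win h).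
Proof. by move=> i j /(congr1 val) /= /addnI/val_inj. Qed.

(** The shape imposed on a member of a facial reduction sequence whose identity
    block occupies the indices from [p] to [q - 1]. *)
Definition tail_id n (C : 'M[R]_n) (p q : nat) : Prop :=
  forall a b : 'I_n, (p <= a)%N -> (p <= b)%N ->
    C a b = ((a == b) && (a < q)%N)%:R.

(** On the window that starts at [p], [C] is the identity of the first [s]
    coordinates, so this is [pdmx_border] there. *)
Lemma pdmx_win_border n p s t (Z C : 'M[R]_n)
    (h : (p + (s + t) <= n)%N) (h' : (p + s + t <= n)%N) :
  Z \is symmetricmx -> tail_id C p (p + s) -> pdmx (mxsub (win h') (win h') Z) ->
  exists l0 : R, forall l, l0 <= l ->
    pdmx (mxsub (win h) (win h) (Z + l *: C)).
Proof.
move=> /symmetricmxP Zs Cid Zpd.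
have Zws : mxsub (win h) (win h) Z \is symmetricmx.
  by apply/symmetricmxP; rewrite trmx_mxsub Zs.
have Zwd : drsubmx (mxsub (win h) (win h) Z) = mxsub (win h') (win h') Z.
  apply/matrixP => i j; rewrite !mxE.
  by congr (Z _ _); apply: val_inj; rewrite /= addnA.
have [|l0 l0P] := pdmx_border Zws; first by rewrite Zwd.
exists l0 => l /l0P; congr pdmx; apply/matrixP => i j.
rewrite !mxE; congr (_ + _ * _); rewrite Cid ?leq_addr //= ltn_add2l.
rewrite (inj_eq (@win_inj _ _ _ h)).
case: split_ordP => i' ->; rewrite mxE; case: split_ordP => j' -> /=;
  by rewrite ?ltn_ord ?andbT ?andbF ?mxE ?eq_lshift ?eq_lrshift
     ?ltnNge ?leq_addr ?andbF.
Qed.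

Lemma win_imgP n p s (h : (p + s <= n)%N) (a : 'I_n) :
  reflect (exists i, a = win h i) (p <= a < p + s)%N.
Proof.
apply: (iffP idP) => [/andP[pa aps]|[i ->]]; last first.
  by rewrite leq_addr ltn_add2l /=.
have i_lt : (a - p < s)%N by rewrite ltn_subLR.
by exists (Ordinal i_lt); apply: val_inj; rewrite /= subnKC.
Qed.

(** The Cholesky factor of the window is extended by the identity: with [E] the
    inclusion of the window, [1 + E (T - 1) E^T] acts as [T] on the range of
    [E] and fixes the other coordinates. *)
Lemma cholesky_win n p s (h : (p + s <= n)%N) (M : 'M[R]_n) :
  pdmx (mxsub (win h) (win h) M) ->
  exists T : 'M[R]_n, [/\ T \in unitmx,
    forall a b : 'I_n, ~~ ((p <= a < p + s)%N && (p <= b < p + s)%N) ->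
      T a b = (a == b)%:R &
    forall a b : 'I_n, (p <= a < p + s)%N -> (p <= b < p + s)%N ->
      (T^T *m M *m T) a b = (a == b)%:R].
Proof.
move=> /pdmx_cholesky[T1 T1u T1M]; set f := win h in T1M.
have f_inj : injective f := @win_inj _ _ _ h.
pose E : 'M[R]_(n, s) := colsub f 1%:M.
have EtE : E^T *m E = 1%:M.
  rewrite trmx_mxsub trmx1 mul_rowsub_mx mul1mx -mxsub_comp.
  by apply/matrixP => i j; rewrite !mxE (inj_eq f_inj).
have EZE Z : E^T *m Z *m E = mxsub f f Z.
  by rewrite trmx_mxsub trmx1 mul_rowsub_mx mul1mx mulmx_colsub mulmx1 -mxsub_comp.
have E0 (a : 'I_n) i : ~~ (p <= a < p + s)%N -> E a i = 0.
  move=> anw; rewrite !mxE; case: eqP => // aE.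
  by case/negP: anw; apply/(win_imgP h); exists i.
pose X (Y : 'M[R]_s) := 1%:M + E *m (Y - 1%:M) *m E^T.
have XE Y : X Y *m E = E *m Y.
  by rewrite mulmxDl mul1mx -!mulmxA EtE mulmx1 mulmxBr mulmx1 addrC subrK.
exists (X T1); split.
- suff /mulmx1_unit[] : X T1 *m X (invmx T1) = 1%:M by [].
  rewrite {2}/X mulmxDr mulmx1 !mulmxA XE -(mulmxA E) mulmxBr mulmxV // mulmx1.
  rewrite /X -addrA -mulmxDl -mulmxDr [_ - 1%:M + _]addrC addrA subrK.
  by rewrite subrr mulmx0 mul0mx addr0.
- move=> a b; rewrite negb_and => ab; rewrite mxE mxE.
  rewrite [X in _ + X](_ : _ = 0) ?addr0 // mxE big1 // => i _.
  case/orP: ab => [anw|bnw]; last by rewrite [E^T i b]mxE E0 ?mulr0.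
  by rewrite mxE big1 ?mul0r // => j _; rewrite E0 ?mul0r.
- move=> _ _ /(win_imgP h)[i ->] /(win_imgP h)[j ->].
  have : (mxsub f f ((X T1)^T *m M *m X T1)) = 1%:M.
    rewrite -T1M -!EZE.
    by rewrite !mulmxA -trmx_mul XE trmx_mul -!mulmxA XE.
  by move=> /matrixP/(_ i j); rewrite !mxE (inj_eq f_inj).
Qed.

End Windows.

(** * Congruences supported on a window *)

Section CongruenceTails.
Variables (R : realType) (n p q : nat) (T : 'M[R]_n).
Hypothesis T_id : forall a b : 'I_n,
  ~~ ((p <= a < q)%N && (p <= b < q)%N) -> T a b = (a == b)%:R.

Let congrE (C : 'M[R]_n) a b :
  (T^T *m C *m T) a b = \sum_d (\sum_c T c a * C c d) * T d b.
Proof.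
rewrite mxE; apply: eq_bigr => d _; rewrite mxE; congr (_ * _).
by apply: eq_bigr => c _; rewrite mxE.
Qed.

Let sum_T_out (F : 'I_n -> R) (b : 'I_n) :
  ~~ (p <= b < q)%N -> \sum_d F d * T d b = F b.
Proof.
move=> bnw; rewrite (bigD1 b) //= T_id ?(negPf bnw) ?andbF // eqxx mulr1.
rewrite big1 ?addr0 // => d db.
by rewrite T_id ?(negPf bnw) ?andbF // (negPf db) mulr0.
Qed.

Let sum_T_in (F : 'I_n -> R) (b : 'I_n) :
  (forall d : 'I_n, (p <= d < q)%N -> F d = 0) -> \sum_d F d * T d b = F b.
Proof.
move=> F0; rewrite (bigD1 b) //= big1 ?addr0 => [|d db].
  have [bw|bnw] := boolP (p <= b < q)%N; first by rewrite F0 ?mul0r.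
  by rewrite T_id ?(negPf bnw) // eqxx mulr1.
have [dw|dnw] := boolP (p <= d < q)%N; first by rewrite F0 ?mul0r.
by rewrite T_id ?(negPf dnw) // (negPf db) mulr0.
Qed.

(** A congruence supported on the indices from [p] to [q - 1] preserves the
    shape of the matrices whose identity block comes after the window: their
    tail is not touched. *)
Lemma congr_tail_below (C : 'M[R]_n) p' q' :
  (q <= p')%N -> tail_id C p' q' -> tail_id (T^T *m C *m T) p' q'.
Proof.
move=> qp' Cid a b pa pb; rewrite congrE sum_T_out; last by lia.
under eq_bigr do rewrite mulrC.
by rewrite sum_T_out; [exact: Cid | lia].
Qed.

(** It also preserves the shape of the matrices whose identity block comes before
    the window: the window then only mixes rows and columns where the tail is
    zero. *)
Lemma congr_tail_above (C : 'M[R]_n) p' q' :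
  (p' <= p)%N -> (q' <= p)%N -> tail_id C p' q' -> tail_id (T^T *m C *m T) p' q'.
Proof.
move=> pp' qp' Cid a b pa pb; rewrite congrE.
have T0 (c a' : 'I_n) : (p' <= a')%N -> (c < p')%N -> T c a' = 0.
  move=> pa' cp'; rewrite T_id; last by lia.
  by case: eqP => // ca; move: pa'; rewrite -ca leqNgt cp'.
rewrite (eq_bigr (fun d => ((d == a) && (d < q')%N)%:R * T d b)) => [|d _].
  rewrite sum_T_in => [|d /andP[pd _]]; last first.
    by rewrite ltnNge (leq_trans qp') ?andbF.
  by rewrite eq_sym; case: eqP => //= ->.
have [dp'|p'd] := ltnP d p'; first by rewrite (T0 d b) ?mulr0.
congr (_ * _).
rewrite (eq_bigr (fun c => ((c == d) && (c < q')%N)%:R * T c a)) => [|c _].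
  rewrite sum_T_in => [|c /andP[pc _]]; last first.
    by rewrite ltnNge (leq_trans qp') ?andbF.
  by rewrite eq_sym; case: eqP => //= ->.
have [cp'|p'c] := ltnP c p'; first by rewrite (T0 c a) ?mulr0 ?mul0r.
by rewrite Cid // mulrC.
Qed.

Lemma congr_tail_merge (C : 'M[R]_n) :
  (forall a b : 'I_n, (p <= a)%N -> (p <= b)%N -> (q <= a)%N || (q <= b)%N ->
    C a b = 0) ->
  (forall a b : 'I_n, (p <= a < q)%N -> (p <= b < q)%N ->
    (T^T *m C *m T) a b = (a == b)%:R) ->
  tail_id (T^T *m C *m T) p q.
Proof.
move=> C0 C1 a b pa pb.
have [/andP[aq bq]|] := boolP ((a < q)%N && (b < q)%N).
  by rewrite C1 ?pa ?pb // aq andbT.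
rewrite negb_and -!leqNgt => out.
have -> : (a == b) && (a < q)%N = false.
  by case: eqP => //= ab; apply/negbTE; rewrite -leqNgt; case/orP: out; rewrite ab.
rewrite congrE big1 // => d _.
have [dp|pd] := ltnP d p.
  rewrite T_id; last by lia.
  by case: eqP => [db|_]; [move: dp; rewrite db ltnNge pb | rewrite mulr0].
rewrite mulr_suml big1 // => c _.
have [cp|pc] := ltnP c p.
  rewrite T_id; last by lia.
  by case: eqP => [db|_]; [move: cp; rewrite db ltnNge pa | rewrite !mul0r].
have [out'|] := boolP ((q <= c)%N || (q <= d)%N); first by rewrite C0 ?mulr0 ?mul0r.
rewrite negb_or -!ltnNge => /andP[cq dq]; case/orP: out => ge.
  rewrite T_id; last by lia.
  by case: eqP => [ca|_]; [move: cq; rewrite ca ltnNge ge | rewrite !mul0r].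
rewrite [T d b]T_id; last by lia.
by case: eqP => [ca|_]; [move: dq; rewrite ca ltnNge ge | rewrite !mulr0].
Qed.

End CongruenceTails.

(** * Regular forms and the merging of two blocks *)

Section RegularForms.
Variables (R : realType) (n : nat).

(** Every permutation is a product of transpositions. *)
Lemma reformulation_perm m (A A' : m.-tuple 'M[R]_n) (B B' : 'M[R]_n)
    (s : 'S_m) :
  reformulation A B A' B' ->
  reformulation A B [tuple tnth A' (s l) | l < m] B'.
Proof.
move=> AA'; have [ts -> tsP] := prod_tpermP s; elim: ts tsP => [_|[i j] ts IH] /=.
  rewrite big_nil (_ : [tuple _ | _ < m] = A') //.
  by apply/eq_from_tnth => l; rewrite tnth_mktuple perm1.
case/andP=> ij tsP; rewrite big_cons /=.
have := reform_exchange (IH tsP) ij.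
congr (reformulation _ _ _ _); apply/eq_from_tnth => l.
by rewrite !tnth_mktuple permM.
Qed.

(** Facial reduction sequences recorded by the partial sums of the block sizes
    instead of the sizes. *)
Definition cut_form (C : seq 'M[R]_n) (k : nat) (P : nat -> nat) : Prop :=
  [/\ P 0%N = 0%N, {homo P : i j / (i <= j)%N}, (P k <= n)%N &
      forall i, (i < k)%N ->
        C`_i \is symmetricmx /\ tail_id C`_i (P i) (P i.+1)].

Lemma cut_form_regular (C : seq 'M[R]_n) k r :
  (k <= size C)%N -> regular_fr_seq (take k C) r ->
  cut_form C k (fun i => sumn (take i r)) /\ sumn (take k r) = sumn r.
Proof.
move=> kC [sr rn Cr]; rewrite size_takel // in sr Cr.
have rk : take k r = r by rewrite -sr take_size.
split; last by rewrite rk.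
split; rewrite ?take0 ?rk //.
  move=> i j ij; rewrite -(subnKC ij) takeD sumn_cat.
  by rewrite leq_addr.
move=> i ik; have [] := Cr i ik; rewrite nth_take // => Cs Cid; split=> //.
by rewrite (take_nth 0%N) ?sr // sumn_rcons.
Qed.

Lemma regular_cut_form (C : seq 'M[R]_n) k P :
  (k <= size C)%N -> cut_form C k P ->
  exists2 r, regular_fr_seq (take k C) r & sumn r = P k.
Proof.
move=> kC [P0 Pmono Pkn CP]; pose r := mkseq (fun i => P i.+1 - P i)%N k.
have sum_r i : (i <= k)%N -> sumn (take i r) = P i.
  elim: i => [|i IH] ik; first by rewrite take0 P0.
  rewrite (take_nth 0%N) ?size_mkseq // sumn_rcons IH 1?ltnW // nth_mkseq //.
  by rewrite subnKC ?Pmono.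
have rk : sumn r = P k by rewrite -sum_r // take_oversize ?size_mkseq.
exists r => //; split; rewrite ?rk ?size_takel ?size_mkseq // => i ik.
have [Cs Cid] := CP i ik; rewrite nth_take // sum_r 1?ltnW //; split=> //= a b.
by rewrite nth_mkseq // subnKC ?Pmono //; apply: Cid.
Qed.

(** If [A_{j+1}] vanishes in the rows of the [j]-th identity block and beyond
    the columns of its own identity block, then [l A_j + A_{j+1}], with [l]
    large, is positive definite on the two blocks together and zero after them;
    so it can stand for both [A_j] and [A_{j+1}]. *)
Lemma merge_blocks m (A A' : m.-tuple 'M[R]_n) (B B' : 'M[R]_n) k P j :
  reformulation A B A' B' -> (k <= m)%N -> cut_form A' k P -> (j.+1 < k)%N ->
  (forall a b : 'I_n, (P j <= a < P j.+1)%N -> (P j.+2 <= b)%N ->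
     A'`_j.+1 a b = 0) ->
  exists A'' B'' P', [/\ reformulation A B A'' B'', cut_form A'' k.-1 P' &
                         P' k.-1 = P k].
Proof.
case: m A A' => [|m] A A' AA' km; first by move: km; case: k.
move=> [P0 Pmono Pkn A'P] jk A'0.
have [A1s A1id] := A'P j.+1 jk; have [A0s A0id] := A'P j (ltnW jk).
have P01 : (P j <= P j.+1)%N by apply: Pmono.
have P12 : (P j.+1 <= P j.+2)%N by apply: Pmono.
have P2n : (P j.+2 <= n)%N by apply: leq_trans Pkn; apply: Pmono.
have A1sym a b : A'`_j.+1 a b = A'`_j.+1 b a.
  by rewrite -{1}(symmetricmxP _ A1s) mxE.
pose s := (P j.+1 - P j)%N; pose t := (P j.+2 - P j.+1)%N.
have ps : (P j + s)%N = P j.+1 by rewrite subnKC.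
have h : (P j + (s + t) <= n)%N by rewrite addnA ps subnKC.
have h' : (P j + s + t <= n)%N by rewrite ps subnKC.
have pst : (P j + (s + t))%N = P j.+2 by rewrite addnA ps subnKC.
have A0id' : tail_id A'`_j (P j) (P j + s) by rewrite ps.
have A1pd : pdmx (mxsub (win h') (win h') A'`_j.+1).
  rewrite (_ : mxsub _ _ _ = 1%:M); first exact: pdmx1.
  have wP i : (P j.+1 <= win h' i)%N by rewrite /= ps leq_addr.
  apply/matrixP => a b; rewrite !mxE (A1id _ _ (wP a) (wP b)) /=.
  rewrite (inj_eq (@win_inj _ _ _ h')) -[X in (_ < X)%N]pst addnA ltn_add2l.
  by rewrite ltn_ord andbT.
have [l0 l0P] := pdmx_win_border h A1s A0id' A1pd.
(* The maximum with 1 makes [l] nonzero, as the replacement of [A_j] by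
   [l A_j + A_{j+1}] requires. *)
pose l := Num.max l0 1.
have l_neq0 : l != 0 by rewrite gt_eqF // lt_max ltr01 orbT.
have /cholesky_win[T [Tu T_id TM]] : pdmx (mxsub (win h) (win h)
    (l *: A'`_j + 1 *: A'`_j.+1)).
  by rewrite scale1r addrC; apply: l0P; rewrite le_max lexx.
rewrite pst in T_id TM.
have jm : (j < m.+1)%N by lia.
have j1m : (j.+1 < m.+1)%N by lia.
have k1m : (k.-1 < m.+1)%N by lia.
pose i0 := Ordinal jm; pose i1 := Ordinal j1m; pose ik := Ordinal k1m.
have i01 : i0 != i1 by rewrite -val_eqE /= neq_ltn ltnSn.
have AA1 := reform_congruence (reform_replace 1 AA' i01 l_neq0) Tu.
(* The cycle sends the matrix that has become superfluous to the position
   [k.-1], just after the shortened sequence; the [i]-th matrix of that sequence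
   is the former one of index [bump j.+1 i]. *)
have := reformulation_perm (lift_perm ik i1 1) AA1.
set A3 := [tuple _ | _ < _]; set B3 := (T^T *m B' *m T) => AA3.
exists A3, B3, (fun i => P (bump j.+1 i)).
split => //; last first.
  by rewrite /bump (_ : (_ <= k.-1)%N) ?add1n ?prednK //; lia.
split.
- by rewrite /bump ltn0.
- by move=> a b ab; apply: Pmono; rewrite /bump; lia.
- by rewrite /bump (_ : (_ <= k.-1)%N) ?add1n ?prednK //; lia.
move=> i ik1.
have im : (i < m.+1)%N by lia.
have bm : (bump j.+1 i < m.+1)%N by rewrite /bump; lia.
have -> : A3`_i = T^T *m (if bump j.+1 i == j then l *: A'`_j + 1 *: A'`_j.+1
                           else A'`_(bump j.+1 i)) *m T.
  rewrite -[i in LHS]/(val (Ordinal im)) -tnth_nth tnth_mktuple.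
  have -> : lift_perm ik i1 1 (Ordinal im) = Ordinal bm.
    have im' : (i < m)%N by lia.
    have -> : Ordinal im = lift ik (Ordinal im').
      by apply: val_inj; rewrite /= /bump leqNgt ik1.
    rewrite (@lift_perm_lift m ik i1 1 (Ordinal im')) perm1.
    by apply: val_inj.
  by rewrite !tnth_mktuple -val_eqE /= !(tnth_nth 0).
split.
  apply/symmetricmxP; rewrite !trmx_mul trmxK mulmxA; congr (_ *m _ *m _).
  case: ifP => _; last by apply/symmetricmxP; apply: (A'P _ _).1; rewrite /bump; lia.
  by rewrite linearD !linearZ /= (symmetricmxP _ A0s) (symmetricmxP _ A1s).
have [ij|ij|ij] := ltngtP i j.
- have -> : bump j.+1 i = i by rewrite /bump; lia.
  have -> : bump j.+1 i.+1 = i.+1 by rewrite /bump; lia.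
  rewrite ltn_eqF //; apply: (congr_tail_above T_id).
  + by apply: Pmono; lia.
  + by apply: Pmono; lia.
  + by apply: (A'P _ _).2; lia.
- have -> : bump j.+1 i = i.+1 by rewrite /bump; lia.
  have -> : bump j.+1 i.+1 = i.+2 by rewrite /bump; lia.
  rewrite gtn_eqF ?ltnS 1?ltnW //; apply: (congr_tail_below T_id).
  + by apply: Pmono; lia.
  + by apply: (A'P _ _).2; lia.
have -> : bump j.+1 i = j by rewrite /bump; lia.
have -> : bump j.+1 i.+1 = j.+2 by rewrite /bump; lia.
rewrite eqxx.
apply: (congr_tail_merge T_id) => // a b pa pb ab.
wlog qb : a b pa pb {ab} / (P j.+2 <= b)%N => [wl|].
  case/orP: ab => [qa|qb]; last by apply: wl.
  have := wl b a pb pa qa; rewrite !mxE A1sym.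
  by rewrite -{1}(symmetricmxP _ A0s) mxE.
have A0ab : A'`_j a b = 0.
  rewrite A0id //; case: eqP => //= ->.
  by rewrite ltnNge (leq_trans P12).
rewrite !mxE A0ab mulr0 add0r mul1r.
have [aq|qa] := ltnP a (P j.+1); first by rewrite A'0 ?pa.
rewrite A1id //; last by apply: leq_trans qb.
by case: eqP => //= ->; rewrite ltnNge qb.
Qed.

End RegularForms.

(** * Growth rates *)

Section Growth.
Variable R : realType.

(** In this statement [da], [db] and [o] are the entries of a two by two minor:
    if [y] dominates [S], the error terms are absorbed by half of [beta * y]
    and half of the resulting quadratic bound. *)
Lemma growth_step (C beta : R) : 0 < C -> 0 < beta ->
  exists K c : R, [/\ 0 < K, 0 < c & forall x y S da db o : R,
    1 <= S -> K * S <= y -> 0 < da -> 0 < db ->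
    da <= x + C * (y + S) -> db <= C * S -> beta * y <= `|o| + C * S ->
    o ^+ 2 <= da * db -> c * y ^+ 2 <= x * S].
Proof.
move=> C_gt0 b_gt0.
pose K := 1 + 2 * C / beta + 16 * C ^+ 2 / beta ^+ 2.
have K1 : 0 <= 2 * C / beta by rewrite divr_ge0 ?mulr_ge0 // ltW.
have K2 : 0 <= 16 * C ^+ 2 / beta ^+ 2 by rewrite divr_ge0 ?sqr_ge0 // mulr_ge0 ?sqr_ge0.
exists K, (beta ^+ 2 / (8 * C)); split.
- by rewrite /K; lra.
- by rewrite divr_gt0 ?exprn_gt0 // mulr_gt0.
move=> x y S da db o S_ge1 KS da_gt0 db_gt0 da_le db_le o_ge minor.
have S_ge0 : 0 <= S by lra.
have yS : S <= y.
  apply: le_trans KS; rewrite -{1}[S]mul1r; apply: ler_wpM2r => //.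
  by rewrite /K; lra.
have y1 : 2 * C * S <= beta * y.
  suff : 2 * C / beta * S <= y.
    by rewrite mulrAC ler_pdivrMr // [y * _]mulrC.
  by apply: le_trans KS; apply: ler_wpM2r => //; rewrite /K; lra.
have y2 : 16 * C ^+ 2 * S <= beta ^+ 2 * y.
  suff : 16 * C ^+ 2 / beta ^+ 2 * S <= y.
    by rewrite mulrAC ler_pdivrMr ?exprn_gt0 // [y * _]mulrC.
  by apply: le_trans KS; apply: ler_wpM2r => //; rewrite /K; lra.
have o_half : beta * y / 2 <= `|o| by lra.
have by_ge0 : 0 <= beta * y / 2 by rewrite divr_ge0 // mulr_ge0 //; lra.
have o2 : (beta * y / 2) ^+ 2 <= da * db.
  apply: le_trans minor; rewrite -[o ^+ 2]real_normK ?num_real //.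
  by rewrite ler_pXn2r ?nnegrE.
have da_db : da * db <= (x + C * (y + S)) * (C * S).
  by apply: ler_pM => //; apply: ltW.
have cross : C ^+ 2 * (y + S) * S <= beta ^+ 2 * y ^+ 2 / 8.
  have -> : C ^+ 2 * (y + S) * S = (C ^+ 2 * S) * (y + S) by ring.
  have -> : beta ^+ 2 * y ^+ 2 / 8 = (beta ^+ 2 * y / 16) * (2 * y) by field.
  apply: ler_pM; rewrite ?mulr_ge0 ?exprn_ge0 //; lra.
rewrite mulrAC ler_pdivrMr ?mulr_gt0 //.
have -> : x * S * (8 * C) = 8 * ((x + C * (y + S)) * (C * S) - C ^+ 2 * (y + S) * S).
  by ring.
have E : (beta * y / 2) ^+ 2 = beta ^+ 2 * y ^+ 2 / 4 by field.
rewrite E in o2; lra.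
Qed.

Definition tail_sum (k : nat) (x : nat -> R) (j : nat) : R :=
  1 + \sum_(j <= i < k) `|x i|.

Lemma tail_sum_ge1 k x j : 1 <= tail_sum k x j.
Proof. by rewrite /tail_sum lerDl sumr_ge0. Qed.

Lemma tail_sum_recl k x j : (j < k)%N ->
  tail_sum k x j = `|x j| + tail_sum k x j.+1.
Proof. by move=> jk; rewrite /tail_sum big_ltn // addrCA. Qed.

(** The last coordinate has [tail_sum] equal to 1 after it, and the exponents
    [k - j] and [k - j.+1] are 1 and 0 there; so the induction starts with an
    inequality between constants. The factor [K] is arbitrary because the one
    that [growth_step] asks of the next coordinate depends on [j]. *)
Lemma growth k (X : (nat -> R) -> Prop) :
  (forall j, (j.+1 < k)%N -> exists C beta : R, [/\ 0 < C, 0 < beta &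
     forall x, X x -> exists da db o : R, [/\ 0 < da /\ 0 < db,
       da <= x j + C * tail_sum k x j.+1, db <= C * tail_sum k x j.+2,
       beta * `|x j.+1| <= `|o| + C * tail_sum k x j.+2 &
       o ^+ 2 <= da * db]]) ->
  forall j, (j < k)%N -> exists2 c : R, 0 < c & forall K, exists M,
    forall x, X x -> M < x k.-1 ->
      K * tail_sum k x j.+1 <= x j /\
      c * tail_sum k x j.+1 ^+ (k - j) <= x j ^+ (k - j.+1).
Proof.
move=> stepX j jk; have [e ke] : exists e, k = (e + j.+1)%N.
  by exists (k - j.+1)%N; rewrite subnK.
elim: e j jk ke => [|e IH] j jk ke.
  rewrite add0n in ke; rewrite ke; exists 1 => // K; exists K => x _ /= Kx.
  rewrite subnn subSnn expr0 /tail_sum big_geq // !addr0 expr1n !mulr1.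
  by split=> //; apply: ltW.
have j1k : (j.+1 < k)%N by rewrite ke; lia.
have ek : (k - j.+1)%N = e.+1 by rewrite ke addnK.
have ek' : (k - j)%N = e.+2 by lia.
have ek'' : (k - j.+2)%N = e by lia.
have [c' c'_gt0 IHj] := IH j.+1 j1k (etrans ke (addSnnS _ _)).
have [C [beta [C_gt0 b_gt0 Xminor]]] := stepX j j1k.
have [K0 [c0 [K0_gt0 c0_gt0 step]]] := growth_step C_gt0 b_gt0.
exists (c0 ^+ e.+1 * c' / 2 ^+ e.+2) => [|K].
  by rewrite divr_gt0 ?exprn_gt0 // mulr_gt0 ?exprn_gt0.
have [M IHM] := IHj (1 + K0 + 2 * `|K| / c0).
exists M => x Xx Mx.
have [] := IHM x Xx Mx; rewrite (tail_sum_recl x j1k).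
set y := x j.+1; set S := tail_sum k x j.+2 => Ky IHpow.
have S_ge1 : 1 <= S by apply: tail_sum_ge1.
have S_ge0 : 0 <= S by lra.
have K_ge0 : 0 <= 2 * `|K| / c0 by rewrite divr_ge0 ?mulr_ge0 // ltW.
have yS : S <= y by apply: le_trans Ky; rewrite -{1}[S]mul1r ler_wpM2r //; lra.
have K0S : K0 * S <= y by apply: le_trans Ky; rewrite ler_wpM2r //; lra.
have KS : 2 * `|K| * S <= c0 * y.
  suff : 2 * `|K| / c0 * S <= y by rewrite mulrAC ler_pdivrMr // [y * _]mulrC.
  by apply: le_trans Ky; rewrite ler_wpM2r //; lra.
have y_gt0 : 0 < y by lra.
have [da [db [o [[da_gt0 db_gt0]]]]] := Xminor x Xx.
rewrite (tail_sum_recl x j1k) -/y -/S gtr0_norm // => da_le db_le o_ge minor.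
have quad : c0 * y ^+ 2 <= x j * S.
  exact: (step (x j) y S da db o).
split.
  have : 2 * `|K| * y * S <= x j * S.
    by apply: le_trans quad; rewrite mulrAC expr2 mulrA ler_wpM2r // ltW.
  rewrite ler_pM2r; last by lra.
  move=> Kyx; apply: le_trans Kyx.
  apply: (@le_trans _ _ (`|K| * (y + S))).
    by rewrite ler_wpM2r ?ler_norm //; lra.
  by rewrite -mulrA mulrCA ler_wpM2l //; lra.
have xj_ge0 : 0 <= x j.
  have : 0 <= x j * S.
    by apply: le_trans quad; rewrite mulr_ge0 ?exprn_ge0 // ltW.
  by rewrite pmulr_lge0 //; lra.
rewrite ek ek'' in IHpow *; rewrite ek'.
have S_pow_gt0 : 0 < S ^+ e.+1 by rewrite exprn_gt0 //; lra.
(* The bound on the next coordinate trades the power of the tail sum in the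
   quadratic inequality for a smaller power of that coordinate. *)
have quad_pow : c0 ^+ e.+1 * y ^+ (2 * e.+1) <= x j ^+ e.+1 * S ^+ e.+1.
  rewrite exprM -!exprMn ler_pXn2r // nnegrE.
    by rewrite mulr_ge0 ?exprn_ge0 // ltW.
  by rewrite mulr_ge0.
have y_pow : c0 ^+ e.+1 * c' * y ^+ e.+2 <= x j ^+ e.+1.
  rewrite -(ler_pM2r S_pow_gt0); apply: le_trans quad_pow.
  have -> : (2 * e.+1)%N = (e + e.+2)%N by rewrite mul2n -addnn addSnnS.
  have -> : c0 ^+ e.+1 * c' * y ^+ e.+2 * S ^+ e.+1 =
            c0 ^+ e.+1 * (c' * S ^+ e.+1) * y ^+ e.+2 by ring.
  rewrite [y ^+ (e + _)]exprD [leRHS]mulrA; apply: ler_wpM2r; first exact: exprn_ge0 (ltW _).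
  by apply: ler_wpM2l => //; exact: exprn_ge0 (ltW _).
apply: le_trans y_pow; rewrite -!mulrA.
apply: ler_wpM2l; first exact: exprn_ge0 (ltW _).
apply: ler_wpM2l; first exact: ltW.
rewrite mulrC ler_pdivrMr ?exprn_gt0 // -exprMn.
by apply: lerXn2r; rewrite ?nnegrE; lra.
Qed.

End Growth.

(** * Pencils in regular form *)

Section Pencils.
Variables (R : realType) (n : nat).

Definition pencil (C : seq 'M[R]_n) (k : nat) (D : 'M[R]_n) (x : nat -> R) :=
  \sum_(i < k) x i *: C`_i + D.

(** The constant matrix collects [B] and the terms of the fixed coordinates. *)
Lemma strictly_feasible_pencil m k (C : m.-tuple 'M[R]_n) (B : 'M[R]_n)
    (xbar : (m - k).-tuple R) : (k <= m)%N ->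
  exists D, forall x : k.-tuple R,
    strictly_feasible C B (x ++ xbar) = pdmx (pencil C k D (nth 0 x)).
Proof.
move=> km; exists (\sum_(k <= i < m) xbar`_(i - k) *: C`_i + B) => x.
rewrite /strictly_feasible /pencil addrA.
suff -> : \sum_(i < m) (x ++ xbar)`_i *: tnth C i =
  \sum_(i < k) x`_i *: C`_i + \sum_(k <= i < m) xbar`_(i - k) *: C`_i by [].
rewrite (eq_bigr (fun i : 'I_m => (x ++ xbar)`_i *: C`_i)) => [|i _]; last first.
  by rewrite (tnth_nth 0).
rewrite -(big_mkord predT (fun i => (x ++ xbar)`_i *: C`_i)) [LHS](big_cat_nat (n := k)) //=.
congr (_ + _).
  by rewrite big_mkord; apply: eq_bigr => i _; rewrite nth_cat size_tuple ltn_ord.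
by apply: eq_big_nat => i /andP[ki _]; rewrite nth_cat size_tuple ltnNge ki.
Qed.

(** The coefficients are raised from the last one to the first: once the
    pencil is positive definite after the [i]-th block, increasing the
    coefficient of [C_i] makes it positive definite from the [i]-th block on. *)
Lemma cut_form_unbounded C k P D x0 : cut_form C k P -> pdmx (pencil C k D x0) ->
  forall N : R, exists x, pdmx (pencil C k D x) /\
    forall i, (i < k)%N -> N <= x i.
Proof.
move=> [P0 Pmono Pkn CP] x0pd N.
have Cs i : (i < k)%N -> (C`_i)^T = C`_i by move=> /CP[/symmetricmxP].
have Ds : D^T = D.
  have [/symmetricmxP] := x0pd; rewrite /pencil linearD linear_sum /= => + _.
  rewrite (eq_bigr (fun i : 'I_k => x0 i *: C`_i)) => [/addrI//|i _].
  by rewrite linearZ /= Cs.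
have Zs x : pencil C k D x \is symmetricmx.
  apply/symmetricmxP; rewrite linearD linear_sum /= Ds; congr (_ + _).
  by apply: eq_bigr => i _; rewrite linearZ /= Cs.
have tail d : (d <= k)%N -> exists x,
    (forall i, (k - d <= i < k)%N -> N <= x i) /\
    forall t (h : (P (k - d) + t <= n)%N), (P (k - d) + t)%N = n ->
      pdmx (mxsub (win h) (win h) (pencil C k D x)).
  elim: d => [|d IH] dk.
    exists x0; split=> [i|t h _]; first by rewrite subn0; case: ltnP; rewrite ?andbF.
    by apply: pdmx_mxsub => //; apply: win_inj.
  have [x [xN xpd]] := IH (ltnW dk); set i := (k - d.+1)%N.
  have iE : (k - d)%N = i.+1 by rewrite /i; lia.
  have ik : (i < k)%N by rewrite /i; lia.
  rewrite iE in xN xpd.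
  have [Ci Cid] := CP i ik; have Pi : (P i <= P i.+1)%N by apply: Pmono.
  have Pin : (P i.+1 <= n)%N by apply: leq_trans Pkn; apply: Pmono.
  pose s := (P i.+1 - P i)%N; pose t := (n - P i.+1)%N.
  have ps : (P i + s)%N = P i.+1 by rewrite subnKC.
  have h' : (P i + s + t <= n)%N by rewrite ps subnKC.
  have h : (P i + (s + t) <= n)%N by rewrite addnA.
  have Cid' : tail_id C`_i (P i) (P i + s) by rewrite ps.
  have pd' : pdmx (mxsub (win h') (win h') (pencil C k D x)).
    by move: h'; rewrite ps => h'; apply: xpd; rewrite subnKC.
  have [l0 l0P] := pdmx_win_border h (Zs x) Cid' pd'.
  pose l := Num.max l0 (N - x i).
  exists (fun i' => x i' + (if i' == i then l else 0)); split=> [i' ii'|t' h1 t'E].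
    have [->|i'i] := eqVneq i' i.
      by rewrite -lerBlDl /l le_max lexx orbT.
    by rewrite addr0; apply: xN; lia.
  have t'st : t' = (s + t)%N by rewrite /s /t; lia.
  move: h1; rewrite t'st => h1; have := l0P l.
  rewrite le_max lexx => /(_ isT).
  have -> : win h1 = win h by apply/funext => a; apply: val_inj.
  suff -> : pencil C k D x + l *: C`_i =
    pencil C k D (fun i' => x i' + (if i' == i then l else 0)) by [].
  rewrite /pencil addrAC; congr (_ + _).
  rewrite (bigD1 (Ordinal ik)) //= [in RHS](bigD1 (Ordinal ik)) //= eqxx.
  rewrite scalerDl addrAC; congr (_ + _ + _); apply: eq_bigr => a.
  by rewrite -val_eqE /= => /negPf ->; rewrite addr0.
have [x [xN xpd]] := tail k (leqnn k); rewrite subnn in xN xpd.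
exists x; split=> [|i ik]; last by apply: xN.
have h : (P 0%N + n <= n)%N by rewrite P0.
have /(xpd n h) : (P 0 + n)%N = n by rewrite P0.
suff -> : mxsub (win h) (win h) (pencil C k D x) = pencil C k D x by [].
apply/matrixP => a b; rewrite mxE.
by congr (fun_of_matrix _ _ _); apply: val_inj; rewrite /= P0.
Qed.

Let entry_bound (C : seq 'M[R]_n) k (D : 'M[R]_n) a b : R :=
  `|D a b| + \sum_(0 <= i < k) `|C`_i a b|.

Let pencilE (C : seq 'M[R]_n) k (D : 'M[R]_n) x j a b :
  (j <= k)%N -> (forall i, (i < j)%N -> C`_i a b = 0) ->
  pencil C k D x a b = \sum_(j <= i < k) x i * C`_i a b + D a b.
Proof.
move=> jk C0; rewrite mxE summxE; congr (_ + _).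
rewrite (eq_bigr (fun i : 'I_k => x i * C`_i a b)) => [|i _]; last by rewrite mxE.
rewrite -(big_mkord predT (fun i => x i * C`_i a b)) [LHS](big_cat_nat (n := j)) //=.
rewrite big1_seq ?add0r // => i; rewrite mem_index_iota => /andP[_ /C0->].
by rewrite mulr0.
Qed.

Let tail_bound (C : seq 'M[R]_n) k (D : 'M[R]_n) (x : nat -> R) j a b : (j <= k)%N ->
  `|\sum_(j <= i < k) x i * C`_i a b + D a b| <=
  entry_bound C k D a b * tail_sum k x j.
Proof.
move=> jk; apply: le_trans (ler_normD _ _) _.
rewrite addrC /tail_sum mulrDr mulr1; apply: lerD.
  by rewrite /entry_bound lerDl sumr_ge0.
apply: le_trans (ler_norm_sum _ _ _) _; rewrite mulr_sumr big_nat [leRHS]big_nat.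
apply: ler_sum => i /andP[ji ik]; rewrite normrM mulrC ler_wpM2r //.
rewrite /entry_bound big_mkord (bigD1 (Ordinal ik)) //= addrCA lerDl.
by rewrite addr_ge0 // sumr_ge0.
Qed.

(** The two by two principal minor in the rows [a] and [b]: the first diagonal
    entry is [x_j], the second one does not involve [x_{j+1}], and the
    off-diagonal one is a multiple of [x_{j+1}], up to terms in later
    coordinates (and, for the first one, in [x_{j+1}]). *)
Lemma minor_bounds (C : seq 'M[R]_n) k P D j (a b : 'I_n) : cut_form C k P -> (j.+1 < k)%N ->
  (P j <= a < P j.+1)%N -> (P j.+2 <= b)%N -> C`_j.+1 a b != 0 ->
  exists c beta : R, [/\ 0 < c, 0 < beta &
    forall x, pdmx (pencil C k D x) -> exists da db o : R, [/\ 0 < da /\ 0 < db,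
      da <= x j + c * tail_sum k x j.+1, db <= c * tail_sum k x j.+2,
      beta * `|x j.+1| <= `|o| + c * tail_sum k x j.+2 &
      o ^+ 2 <= da * db]].
Proof.
move=> [P0 Pmono Pkn CP] jk /andP[Pa aP] Pb Cab.
have eb_ge0 u v : 0 <= entry_bound C k D u v by rewrite addr_ge0 ?sumr_ge0.
pose c := 1 + (entry_bound C k D a a + entry_bound C k D b b +
  entry_bound C k D a b).
have := (eb_ge0 a a, eb_ge0 b b, eb_ge0 a b) => -[[ea eb] eab].
exists c, `|C`_j.+1 a b|; split; rewrite ?normr_gt0 //; first by rewrite /c; lra.
move=> x xpd; have ab : a != b.
  apply: contraTneq Pb => <-; rewrite -ltnNge (leq_trans aP) //.
  exact: Pmono.
have jk' := ltnW jk.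
have S1 := tail_sum_ge1 k x j.+1; have S2 := tail_sum_ge1 k x j.+2.
have Cid i (u v : 'I_n) : (i < k)%N -> (P i <= u)%N -> (P i <= v)%N ->
    C`_i u v = ((u == v) && (u < P i.+1)%N)%:R.
  by move=> ik; apply: (CP i ik).2.
have leP i i' : (i <= i')%N -> (P i <= P i')%N := @Pmono i i'.
exists (pencil C k D x a a), (pencil C k D x b b), (pencil C k D x a b).
split; [by split; exact: pdmx_diag_gt0 | | | | exact: pdmx_minor2].
- rewrite (pencilE _ _ (ltnW jk')) => [|i ij]; last first.
  + have Pia : (P i.+1 <= a)%N by apply: leq_trans Pa; apply: leP.
    have Pia' : (P i <= a)%N by apply: leq_trans Pia; apply: leP.
    by rewrite Cid ?(ltn_trans ij) // eqxx ltnNge Pia.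
  rewrite big_ltn // Cid // eqxx aP mulr1 -addrA lerD2l.
  apply: le_trans (ler_norm _) _; apply: le_trans (tail_bound _ _ _ _ _ _) _ => //.
  by rewrite ler_wpM2r ?(le_trans ler01) // /c; lra.
- rewrite (pencilE _ _ jk) => [|i ij]; last first.
  + have Pib : (P i.+1 <= b)%N by apply: leq_trans Pb; apply: leP.
    have Pib' : (P i <= b)%N by apply: leq_trans Pib; apply: leP.
    by rewrite Cid ?(leq_trans ij) // eqxx ltnNge Pib.
  apply: le_trans (ler_norm _) _; apply: le_trans (tail_bound _ _ _ _ _ _) _ => //.
  by rewrite ler_wpM2r ?(le_trans ler01) // /c; lra.
- rewrite (pencilE _ _ jk') => [|i ij]; last first.
  + have Pia : (P i <= a)%N by apply: leq_trans Pa; apply: leP.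
    have Pib : (P i <= b)%N by apply: leq_trans Pb; apply: leP; lia.
    by rewrite Cid ?(ltn_trans ij) // (negPf ab).
  rewrite big_ltn //; set rest := \sum_(_ <= i < k) _.
  have := @tail_bound C k D x j.+2 a b jk; rewrite -/rest => rest_le.
  have : `|C`_j.+1 a b| * `|x j.+1| <=
      `|x j.+1 * C`_j.+1 a b + (rest + D a b)| + `|rest + D a b|.
    by rewrite mulrC -normrM -{1}[_ * _](addrK (rest + D a b)) ler_normB.
  rewrite addrA => /le_trans; apply; rewrite lerD2l; apply: le_trans rest_le _.
  by rewrite ler_wpM2r ?(le_trans ler01) // /c; lra.
Qed.

End Pencils.

(** * Singularity degree and the main estimate *)

Lemma powR_le_root (R : realType) (c x y : R) (e : nat) :
  (0 < e)%N -> 0 < c -> 0 <= x -> 0 <= y -> c * y ^+ e.+1 <= x ^+ e ->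
  c `^ e%:R^-1 * y `^ (1 + e%:R^-1) <= x.
Proof.
move=> e_gt0 c_gt0 x_ge0 y_ge0 le_pow.
have e_neq0 : e%:R != 0 :> R by rewrite pnatr_eq0 -lt0n.
have -> : 1 + e%:R^-1 = e.+1%:R * e%:R^-1 :> R.
  by rewrite -natr1 mulrDl divff // mul1r.
have yn_ge0 : 0 <= y ^+ e.+1 by rewrite exprn_ge0.
rewrite powRrM powR_mulrn // -powRM //; last exact: ltW.
apply: (@le_trans _ _ ((x ^+ e) `^ e%:R^-1)).
  apply: ge0_ler_powR => //; rewrite ?invr_ge0 ?ler0n // nnegrE.
    by rewrite mulr_ge0 // ltW.
  by rewrite exprn_ge0.
by rewrite -powR_mulrn // -powRrM divff // powRr1.
Qed.

(** Otherwise the [j]-th and [j.+1]-st blocks merge into one and the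
    singularity degree drops. *)
Lemma singularity_degree_tail (R : realType) n m k (A A' : m.-tuple 'M[R]_n)
    (B B' : 'M[R]_n) P j :
  singularity_degree A B k -> reformulation A B A' B' -> (k <= m)%N ->
  max_psd_rank A (n - P k) -> cut_form A' k P -> (j.+1 < k)%N ->
  exists a b : 'I_n, [/\ (P j <= a < P j.+1)%N, (P j.+2 <= b)%N &
                         A'`_j.+1 a b != 0].
Proof.
move=> [_ k_min] AA' km rankA cutA' jk.
have [//|no_entry] := pselect (exists a b : 'I_n, [/\ (P j <= a < P j.+1)%N,
  (P j.+2 <= b)%N & A'`_j.+1 a b != 0]).
have [|A'' [B'' [P' [AA'' cutA'' P'k]]]] := merge_blocks AA' km cutA' jk.
  move=> a b Pa Pb; apply/eqP; apply: contra_notT no_entry => Cab.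
  by exists a, b.
have k1m : (k.-1 <= m)%N by apply: leq_trans (leq_pred k) km.
have [|r rA'' sum_r] := regular_cut_form _ cutA''; first by rewrite size_tuple.
have /k_min : exists A' B', regular_form A B k.-1 A' B'.
  by exists A'', B''; split=> //; exists r; rewrite ?sum_r ?P'k.
by case: k jk {k_min km rankA cutA' P'k k1m cutA'' rA'' sum_r} => // k _; rewrite ltnn.
Qed.

(* Sequences are indexed from 0: the entry x_j of x_1, ..., x_k is x`_j.-1. *)
Theorem theorem1 (R : realType) (n m k : nat)
    (A : m.-tuple 'M[R]_n) (B : 'M[R]_n)
    (A' : m.-tuple 'M[R]_n) (B' : 'M[R]_n)
    (xbar : (m - k).-tuple R)
    (A_sym : forall i : 'I_m, tnth A i \is symmetricmx)
    (B_sym : B \is symmetricmx)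
    (A_int : forall i : 'I_m, tnth A i \is a mxOver Num.int)
    (B_int : B \is a mxOver Num.int)
    (A_free : free A)
    (P_feas : exists z : m.-tuple R, strictly_feasible A B z)
    (k_sd : singularity_degree A B k)
    (P'_reg : regular_form A B k A' B')
    (k_ge2 : (2 <= k)%N)
    (xbar_feas : exists x : k.-tuple R, strictly_feasible A' B' (x ++ xbar)) :
  (forall N : R, exists x : k.-tuple R,
      strictly_feasible A' B' (x ++ xbar) /\ N <= x`_k.-1) /\
  (exists (d alpha : nat -> R) (M : R),
    [/\ forall j, (2 <= j <= k)%N -> 0 < d j /\ 0 < alpha j,
        forall x : k.-tuple R,
          strictly_feasible A' B' (x ++ xbar) -> M < x`_k.-1 ->
          forall j, (1 <= j <= k.-1)%N ->
            d j.+1 * x`_(j.+1).-1 `^ alpha j.+1 <= x`_j.-1 &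
        forall j, (1 <= j <= k.-1)%N ->
          1 + ((k - j)%:R)^-1 <= alpha j.+1 <= 2]).
Proof.
have [AA' km [r regA' rankA]] := P'_reg.
have [] := @cut_form_regular _ _ A' k r _ regA'; first by rewrite size_tuple.
set P := fun i => sumn (take i r) => cutA' Pk.
rewrite -Pk -[sumn _]/(P k) in rankA.
have [D feasE] := strictly_feasible_pencil A' B' xbar km.
split=> [N|].
  have [x0 x0_feas] := xbar_feas; rewrite feasE in x0_feas.
  have [x [xpd xN]] := cut_form_unbounded cutA' x0_feas N.
  have nth_x i : (i < k)%N -> [tuple x i | i < k]`_i = x i.
    by move=> ik; rewrite -[i]/(val (Ordinal ik)) -tnth_nth tnth_mktuple.
  exists [tuple x i | i < k]; split; last by rewrite nth_x ?xN //; lia.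
  rewrite feasE; suff -> : pencil A' k D (nth 0 [tuple x i | i < k]) =
    pencil A' k D x by [].
  by rewrite /pencil; congr (_ + _); apply: eq_bigr => i _; rewrite nth_x.
have rate j : exists cM : R * R, (j < k)%N -> 0 < cM.1 /\
    forall x, pdmx (pencil A' k D x) -> cM.2 < x k.-1 ->
      0 <= x j /\ cM.1 * tail_sum k x j.+1 ^+ (k - j) <= x j ^+ (k - j.+1).
  have [jk|] := ltnP j k; last by exists (0, 0).
  have [|c c_gt0 /(_ 0)[M cM]] := @growth _ k (fun x => pdmx (pencil A' k D x)) _ j jk.
    move=> i ik.
    have [a [b [Pa Pb Cab]]] := singularity_degree_tail k_sd AA' km rankA cutA' ik.
    exact: minor_bounds cutA' ik Pa Pb Cab.
  by exists (c, M) => _; split=> // x xpd /(cM x xpd); rewrite mul0r.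
have [cM cMP] := choice rate.
exists (fun j => (cM j.-2).1 `^ ((k - j.-1)%:R)^-1), (fun j => 1 + ((k - j.-1)%:R)^-1),
  (\sum_(i < k) `|(cM i).2|).
have inv_ge0 i : 0 <= (i%:R : R)^-1 by rewrite invr_ge0 ler0n.
split.
- move=> j /andP[j2 jk]; have [|c_gt0 _] := cMP j.-2; first by lia.
  by rewrite powR_gt0 // ltr_pwDl.
- move=> x; rewrite feasE => xpd Mx [//|j] /andP[_ jk] /=.
  have j1k : (j.+1 < k)%N by lia.
  have le_M i : (i < k)%N -> (cM i).2 < x`_k.-1.
    move=> ik; apply: le_lt_trans Mx; apply: le_trans (ler_norm _) _.
    by rewrite (bigD1 (Ordinal ik)) //= lerDl sumr_ge0.
  have [c_gt0 /(_ _ xpd (le_M _ (ltnW j1k)))[xj_ge0 xj_ge]] := cMP j (ltnW j1k).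
  have [_ /(_ _ xpd (le_M _ j1k))[y_ge0 _]] := cMP j.+1 j1k.
  apply: powR_le_root; rewrite ?subn_gt0 //.
  apply: le_trans xj_ge; rewrite subnSK 1?ltnW //.
  apply: ler_wpM2l; first exact: ltW.
  have S_ge1 : 1 <= tail_sum k (nth 0 x) j.+1 by apply: tail_sum_ge1.
  apply: lerXn2r; rewrite ?nnegrE ?(le_trans ler01 S_ge1) //.
  rewrite tail_sum_recl // ger0_norm // lerDl (le_trans ler01) //.
  exact: tail_sum_ge1.
- move=> [//|j] /andP[_ jk] /=; rewrite lexx /= -[2]/(1 + 1 : R) lerD2l.
  have e_gt0 : (0 < k - j.+1)%N by lia.
  by rewrite invf_le1 ?ltr0n // ler1n.
Qed.
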